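(* Let $\Gamma$ be a countable group and $\Lambda\le\Gamma$ a coamenable subgroup. Then the restriction map $\operatorname{H}_a^n(\Gamma,\mathcal{V})\to\operatorname{H}_a^n(\Lambda,\mathcal{V})$ is injective, for all $n\ge 0$ and all dual asymptotic Banach ${}^{*}\Gamma$-modules $\mathcal{V}$.
   Context: A subgroup $\Lambda\le\Gamma$ is *coamenable* if there is a $\Gamma$-invariant mean on $\Gamma/\Lambda$, i.e. a linear functional $m:\ell^\infty(\Gamma/\Lambda)\to\mathbb{R}$ with $m(1)=1$, $|m(f)|\le\|f\|$ and $m(g\cdot f)=m(f)$ for all $g\in\Gamma$, $f\in\ell^\infty(\Gamma/\Lambda)$. All groups are discrete and countable. **Asymptotic modules.** Fix a non-principal ultrafilter $\omega$ on $\mathbb{N}$. For sets $X_n$, $\prod_\omega X_n$ is the algebraic ultraproduct (sequences modulo equality on a set in $\omega$). ${}^{*}G=\prod_\omega G$ for a group $G$, ${}^{*}\mathbb{R}=\prod_\omega\mathbb{R}$, ${}^{*}\mathbb{R}_b$ is the set of bounded hyperreals and ${}^{*}\mathbb{R}_{inf}$ the set of infinitesimals. A map between ultraproducts is *internal* if it is induced by a sequence of maps. For Banach spaces $V_n$ let $\mathcal{V}=\prod_\omega V_n$ with ${}^{*}\mathbb{R}$-valued norm $\|\{v_n\}_\omega\|=\{\|v_n\|\}_\omega$, $\mathcal{V}_b=\{v:\|v\|\in{}^{*}\mathbb{R}_b\}$, $\mathcal{V}_{inf}=\{v:\|v\|\in{}^{*}\mathbb{R}_{inf}\}$ and $\widetilde{\mathcal{V}}=\mathcal{V}_b/\mathcal{V}_{inf}$,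 a real Banach space. An *asymptotic Banach ${}^{*}G$-module* is such a $\mathcal{V}$ together with an internal map $\pi=\{\pi_n\}_\omega:{}^{*}G\times\mathcal{V}\to\mathcal{V}$, where each $\pi_n(g):V_n\to V_n$ is linear and norm-preserving, which induces an isometric linear action $\tilde\pi$ of ${}^{*}G$ on $\widetilde{\mathcal{V}}$. The internal dual is $\mathcal{V}^\#=\prod_\omega V_n^\#$ ($V_n^\#$ the continuous dual), with the contragredient $\pi^\#$ defined coordinatewise by $(\pi_n^\#(g)\lambda)(v)=\lambda(\pi_n(g^{-1})v)$. $\mathcal{V}$ is a *dual* asymptotic Banach ${}^{*}G$-module if it is the internal dual, with contragredient action, of some asymptotic Banach ${}^{*}G$-module $\mathcal{V}^\flat$. **Asymptotic cohomology.** For $m\ge1$ let $\mathcal{L}^\infty(({}^{*}G)^m,\mathcal{V})=\prod_\omega\ell^\infty(G^m,V_n)$, with bounded and infinitesimal parts (for the sup norms) $\mathcal{L}^\infty_b$, $\mathcal{L}^\infty_{inf}$ and quotient $\widetilde{\mathcal{L}}^\infty(({}^{*}G)^m,\mathcal{V})=\mathcal{L}^\infty_b/\mathcal{L}^\infty_{inf}$. ${}^{*}G$ acts on this quotient via $(g\cdot f)(g_1,\dots,g_m)=\pi(g)f(g^{-1}g_1,\dots,g^{-1}g_m)$; invariants are denoted by the superscript ${}^{*}G$. Define $d^m:\mathcal{L}^\infty(({}^{*}G)^m,\mathcal{V})\to\mathcal{L}^\infty(({}^{*}G)^{m+1},\mathcal{V})$ by $d^m f(g_0,\dots,g_m)=\sum_{j=0}^m(-1)^jf(g_0,\dots,\widehat{g_j},\dots,g_m)$.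 It induces maps $\tilde d^m$ giving the complex $0\xrightarrow{\tilde d^0}\widetilde{\mathcal{L}}^\infty({}^{*}G,\mathcal{V})^{{}^{*}G}\xrightarrow{\tilde d^1}\widetilde{\mathcal{L}}^\infty(({}^{*}G)^2,\mathcal{V})^{{}^{*}G}\xrightarrow{\tilde d^2}\cdots$, and $\operatorname{H}_a^m(G,\mathcal{V})=\ker(\tilde d^{m+1})/\operatorname{im}(\tilde d^m)$ for $m\ge0$. **Restriction map.** A dual asymptotic Banach ${}^{*}\Gamma$-module restricts to a dual asymptotic Banach ${}^{*}\Lambda$-module. Restriction of cochains $\widetilde{\mathcal{L}}^\infty(({}^{*}\Gamma)^\bullet,\mathcal{V})^{{}^{*}\Gamma}\to\widetilde{\mathcal{L}}^\infty(({}^{*}\Lambda)^\bullet,\mathcal{V})^{{}^{*}\Lambda}$ induces the *restriction map* $\operatorname{H}_a^\bullet(\Gamma,\mathcal{V})\to\operatorname{H}_a^\bullet(\Lambda,\mathcal{V})$. *)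

(* Defs.v *)
From HB Require Import structures.
From mathcomp Require Import all_boot all_order all_algebra.
From mathcomp Require Import all_classical all_reals all_analysis.
From mathcomp Require Import zify lra.
Import numFieldNormedType.Exports.

Set Implicit Arguments.
Unset Strict Implicit.
Unset Printing Implicit Defensive.

Import Order.TTheory GRing.Theory Num.Theory.

Local Open Scope classical_set_scope.
Local Open Scope quotient_scope.
Local Open Scope ring_scope.

Structure npUltrafilter := NPUltrafilter {
  npuf :> set_system nat;
  npuf_ultra : UltraFilter npuf;
  npuf_nonprincipal : forall n, ~ npuf [set n] }.
#[global] Existing Instance npuf_ultra.

Section Ultraproduct.
Variable omega : npUltrafilter.

Section Def.
Variable X : nat -> Type.

Definition ueq (x y : {classic forall n, X n}) : bool :=
  `[< \forall n \near npuf omega, x n = y n >].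

Lemma ueq_equiv : equiv_class_of ueq.
Proof.
split=> [x|x y|y x z]; rewrite /ueq.
- by apply/asboolP; near=> n.
- apply/asboolP/asboolP => h; near=> n; symmetry; near: n; exact: h.
- move=> /asboolP xy /asboolP yz; apply/asboolP.
  by near=> n; transitivity (y n); near: n.
Unshelve. all: by end_near. Qed.
Canonical ueq_equivrel := EquivRelPack ueq_equiv.
Canonical ueq_encModRel := defaultEncModRel ueq.

(* The algebraic ultraproduct of the X n. *)
Definition uprod : Type := {eq_quot ueq}.
HB.instance Definition _ : EqQuotient _ ueq uprod := EqQuotient.on uprod.
HB.instance Definition _ := Choice.on uprod.

Definition uclass (x : forall n, X n) : uprod := \pi_uprod x.
Definition urepr (x : uprod) : forall n, X n := repr x.

Lemma ureprK x : uclass (urepr x) = x. Proof. exact: reprK. Qed.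

Lemma uclassP (x y : forall n, X n) :
  uclass x = uclass y <-> \forall n \near npuf omega, x n = y n.
Proof.
split=> [/eqP|h]; first by rewrite piE => /asboolP.
by apply/eqP; rewrite piE; apply/asboolP.
Qed.

Lemma urepr_class (x : forall n, X n) :
  \forall n \near npuf omega, urepr (uclass x) n = x n.
Proof. by apply/uclassP; rewrite ureprK. Qed.

End Def.

(* The internal map induced by the sequence F. *)
Definition umap (X Y : nat -> Type) (F : forall n, X n -> Y n) (x : uprod X) :
    uprod Y :=
  uclass (fun n => F n (urepr x n)).

Definition umap2 (X Y Z : nat -> Type) (F : forall n, X n -> Y n -> Z n)
    (x : uprod X) (y : uprod Y) : uprod Z :=
  uclass (fun n => F n (urepr x n) (urepr y n)).

Lemma umapE X Y (F : forall n, X n -> Y n) x :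
  umap F (uclass x) = uclass (fun n => F n (x n)).
Proof.
by apply/uclassP; near=> n; congr (F n); near: n; exact: urepr_class.
Unshelve. all: by end_near. Qed.

Lemma umap2E X Y Z (F : forall n, X n -> Y n -> Z n) x y :
  umap2 F (uclass x) (uclass y) = uclass (fun n => F n (x n) (y n)).
Proof.
by apply/uclassP; near=> n; congr (F n); near: n; exact: urepr_class.
Unshelve. all: by end_near. Qed.

Lemma umap_near X Y (F F' : forall n, X n -> Y n) :
  (\forall n \near npuf omega, F n =1 F' n) -> umap F =1 umap F'.
Proof.
move=> FF' x; apply/uclassP; near=> n.
by have : F n =1 F' n by near: n.
Unshelve. all: by end_near. Qed.

Section Zmodule.
Variable X : nat -> zmodType.
Notation U := (uprod (fun n => X n)).

Definition uzero : U := uclass (fun=> 0).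
Definition uopp : U -> U := umap (fun n (x : X n) => - x).
Definition uadd : U -> U -> U := umap2 (fun n (x y : X n) => x + y).

Lemma uaddA : associative uadd.
Proof.
move=> x y z; rewrite -[x]ureprK -[y]ureprK -[z]ureprK /uadd !umap2E.
by congr uclass; apply: functional_extensionality_dep => n; rewrite addrA.
Qed.
Lemma uaddC : commutative uadd.
Proof.
move=> x y; rewrite -[x]ureprK -[y]ureprK /uadd !umap2E.
by congr uclass; apply: functional_extensionality_dep => n; rewrite addrC.
Qed.
Lemma uadd0 : left_id uzero uadd.
Proof.
move=> x; rewrite -[x]ureprK /uadd !umap2E.
by congr uclass; apply: functional_extensionality_dep => n; rewrite add0r.
Qed.
Lemma uaddN : left_inverse uzero uopp uadd.
Proof.
move=> x; rewrite -[x]ureprK /uadd /uopp !umapE !umap2E.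
by congr uclass; apply: functional_extensionality_dep => n; rewrite addNr.
Qed.
HB.instance Definition _ := GRing.isZmodule.Build U uaddA uaddC uadd0 uaddN.
End Zmodule.

Section Group.
Variable X : nat -> groupType.
Notation U := (uprod (fun n => X n)).

Definition uone : U := uclass (fun=> 1%g).
Definition uinv : U -> U := umap (fun n (x : X n) => x^-1%g).
Definition umul : U -> U -> U := umap2 (fun n (x y : X n) => (x * y)%g).

Lemma umulA : associative umul.
Proof.
move=> x y z; rewrite -[x]ureprK -[y]ureprK -[z]ureprK /umul !umap2E.
by congr uclass; apply: functional_extensionality_dep => n; rewrite mulgA.
Qed.
Lemma umul1g : left_id uone umul.
Proof.
move=> x; rewrite -[x]ureprK /umul !umap2E.
by congr uclass; apply: functional_extensionality_dep => n; rewrite mul1g.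
Qed.
Lemma umulg1 : right_id uone umul.
Proof.
move=> x; rewrite -[x]ureprK /umul !umap2E.
by congr uclass; apply: functional_extensionality_dep => n; rewrite mulg1.
Qed.
Lemma umulVg : left_inverse uone uinv umul.
Proof.
move=> x; rewrite -[x]ureprK /umul /uinv !umapE !umap2E.
by congr uclass; apply: functional_extensionality_dep => n; rewrite mulVg.
Qed.
Lemma umulgV : right_inverse uone uinv umul.
Proof.
move=> x; rewrite -[x]ureprK /umul /uinv !umapE !umap2E.
by congr uclass; apply: functional_extensionality_dep => n; rewrite mulgV.
Qed.
HB.instance Definition _ :=
  isGroup.Build U umulA umul1g umulg1 umulVg umulgV.
End Group.

End Ultraproduct.

Notation star omega T := (uprod omega (fun _ : nat => T)).

Section Subquotient.

Definition subtype_of (A : zmodType) (Z : zmodClosed A) : Type :=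
  {x : A | x \in Z}.
HB.instance Definition _ (A : zmodType) (Z : zmodClosed A) :=
  SubChoice.on (subtype_of Z).
HB.instance Definition _ (A : zmodType) (Z : zmodClosed A) :=
  [SubChoice_isSubZmodule of subtype_of Z by <:].

Section Def.
Variables (A : zmodType) (Z B : zmodClosed A).

(* Z / B for subgroups B <= Z of A, built as the quotient of Z by the subgroup
   of those of its elements that lie in B. *)
Definition sub_rel : {pred subtype_of Z} := [pred x | \val x \in B].

Lemma sub_rel_zmod_closed : zmod_closed sub_rel.
Proof.
split=> [|x y]; rewrite !inE ?raddf0 ?rpred0 // => xB yB.
by rewrite raddfB rpredB.
Qed.
HB.instance Definition _ :=
  GRing.isZmodClosed.Build (subtype_of Z) sub_rel sub_rel_zmod_closed.

Definition subquot : zmodType := {ideal_quot sub_rel}.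

Definition sqclass (x : A) (xZ : x \in Z) : subquot :=
  \pi_{ideal_quot sub_rel} (Sub x xZ : subtype_of Z).

Definition sqrepr (x : subquot) : A := \val (repr x : subtype_of Z).

Lemma sqreprP (x : subquot) : sqrepr x \in Z.
Proof. exact: (valP (repr x : subtype_of Z)). Qed.

Lemma sqreprK (x : subquot) : sqclass (sqreprP x) = x.
Proof.
rewrite /sqclass -[RHS]reprK; congr (\pi_{ideal_quot sub_rel} _).
by apply/val_inj; rewrite SubK.
Qed.

Lemma sqclassP x y (xZ : x \in Z) (yZ : y \in Z) :
  sqclass xZ = sqclass yZ <-> x - y \in B.
Proof.
rewrite /sqclass; split => [/eqP|xyB].
  by rewrite piE Quotient.equivE inE raddfB.
by apply/eqP; rewrite piE Quotient.equivE inE raddfB.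
Qed.

Lemma sqclass0 : sqclass (rpred0 Z) = 0.
Proof. by rewrite /sqclass -[RHS](raddf0 \pi_{ideal_quot sub_rel}); congr (\pi_{ideal_quot _} _); apply/val_inj. Qed.

Lemma sqrepr_class x (xZ : x \in Z) : sqrepr (sqclass xZ) - x \in B.
Proof. by apply/(sqclassP (sqreprP _) xZ); rewrite sqreprK. Qed.

End Def.
Arguments sqclass0 {A} Z B.

(* The map Z / B -> Z' / B' induced by f, through representatives; for f
   additive with f(B) <= B' see subquot_mapE. *)
Definition subquot_map (A A' : zmodType) (Z B : zmodClosed A)
    (Z' B' : zmodClosed A') (f : A -> A')
    (fZ : forall x, x \in Z -> f x \in Z') (x : subquot Z B) : subquot Z' B' :=
  sqclass B' (fZ _ (sqreprP x)).

Lemma subquot_mapE (A A' : zmodType) (Z B : zmodClosed A)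
    (Z' B' : zmodClosed A') (f : {additive A -> A'})
    (fZ : forall x, x \in Z -> f x \in Z')
    (fB : forall x, x \in B -> f x \in B') x (xZ : x \in Z) :
  subquot_map B' fZ (sqclass B xZ) = sqclass B' (fZ x xZ).
Proof.
apply/sqclassP; rewrite -raddfB; apply: fB; exact: sqrepr_class.
Qed.

Lemma subquot_map_is_zmod_morphism (A A' : zmodType) (Z B : zmodClosed A)
    (Z' B' : zmodClosed A') (f : {additive A -> A'})
    (fZ : forall x, x \in Z -> f x \in Z')
    (fB : forall x, x \in B -> f x \in B') :
  zmod_morphism (subquot_map B' fZ : subquot Z B -> subquot Z' B').
Proof.
move=> x y; have sqclassB (C : zmodType) (P Q : zmodClosed C) u v
    (uP : u \in P) (vP : v \in P) :
    sqclass Q uP - sqclass Q vP = sqclass Q (rpredB uP vP).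
  rewrite /sqclass -raddfB; congr (\pi_{ideal_quot _} _).
  by apply/val_inj; rewrite raddfB /=.
rewrite -[x]sqreprK -[y]sqreprK sqclassB !subquot_mapE// sqclassB.
by apply/sqclassP; rewrite raddfB subrr rpred0.
Qed.

End Subquotient.

Section Tilde.
Variables (R : realType) (omega : npUltrafilter).

Definition hbounded (x : star omega R) : Prop :=
  exists M : R, \forall n \near npuf omega, `|urepr x n| <= M.

Definition hinfinitesimal (x : star omega R) : Prop :=
  forall e : R, 0 < e -> \forall n \near npuf omega, `|urepr x n| < e.

Section Def.
Variable X : nat -> normedModType R.
Notation U := (uprod omega (fun n => X n)).

Definition unorm : U -> star omega R := umap (fun n (x : X n) => `|x|).

Definition ubounded : {pred U} := fun x => `[< hbounded (unorm x) >].
Definition uinfinitesimal : {pred U} := fun x => `[< hinfinitesimal (unorm x) >].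

Lemma urepr_unorm (x : forall n, X n) :
  \forall n \near npuf omega, `|urepr (unorm (uclass omega x)) n| = `|x n|.
Proof.
rewrite /unorm umapE; near=> n.
have -> : urepr (uclass omega (fun n => `|x n|)) n = `|x n|.
  by near: n; exact: urepr_class.
by rewrite normr_id.
Unshelve. all: by end_near. Qed.

Lemma uboundedP (x : forall n, X n) :
  reflect (exists M : R, \forall n \near npuf omega, `|x n| <= M)
    (uclass omega x \in ubounded).
Proof.
have H := urepr_unorm x.
apply: (iffP (asboolP _)) => -[M hM]; exists M; near=> n.
- have <- : `|urepr (unorm (uclass omega x)) n| = `|x n| by near: n.
  by near: n.
- have -> : `|urepr (unorm (uclass omega x)) n| = `|x n| by near: n.
  by near: n.
Unshelve. all: by end_near. Qed.

Lemma uinfinitesimalP (x : forall n, X n) :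
  reflect (forall e : R, 0 < e -> \forall n \near npuf omega, `|x n| < e)
    (uclass omega x \in uinfinitesimal).
Proof.
have H := urepr_unorm x.
apply: (iffP (asboolP _)) => h e e0; have he := h e e0; near=> n.
- have <- : `|urepr (unorm (uclass omega x)) n| = `|x n| by near: n.
  by near: n.
- have -> : `|urepr (unorm (uclass omega x)) n| = `|x n| by near: n.
  by near: n.
Unshelve. all: by end_near. Qed.

Lemma uclassB (x y : forall n, X n) :
  uclass omega x - uclass omega y = uclass omega (fun n => x n - y n) :> U.
Proof. by rewrite [- _]umapE [_ + _]umap2E. Qed.

Lemma ubounded_zmod_closed : zmod_closed ubounded.
Proof.
split=> [|x y].
  by apply/uboundedP; exists 0; near=> n; rewrite normr0.
rewrite -[x]ureprK -[y]ureprK uclassB => /uboundedP[M hM] /uboundedP[N hN].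
apply/uboundedP; exists (M + N); near=> n.
rewrite (le_trans (ler_normB _ _))// lerD//; by near: n.
Unshelve. all: by end_near. Qed.
HB.instance Definition _ :=
  GRing.isZmodClosed.Build U ubounded ubounded_zmod_closed.

Lemma uinfinitesimal_zmod_closed : zmod_closed uinfinitesimal.
Proof.
split=> [|x y].
  by apply/uinfinitesimalP => e e0; near=> n; rewrite normr0.
rewrite -[x]ureprK -[y]ureprK uclassB => /uinfinitesimalP h /uinfinitesimalP k.
apply/uinfinitesimalP => e e0; have e2 : 0 < e / 2 by rewrite divr_gt0.
have := h _ e2; have := k _ e2 => {}k {}h; near=> n.
rewrite (le_lt_trans (ler_normB _ _))// [ltRHS]splitr ltrD//; by near: n.
Unshelve. all: by end_near. Qed.
HB.instance Definition _ :=
  GRing.isZmodClosed.Build U uinfinitesimal uinfinitesimal_zmod_closed.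

(* Bounded elements modulo infinitesimal ones. This serves both for the Banach
   space attached to an asymptotic module and for the cochain spaces; only its
   additive structure is recorded. *)
Definition tilde : zmodType := subquot ubounded uinfinitesimal.

End Def.
Arguments ubounded : clear implicits.
Arguments uinfinitesimal : clear implicits.
Arguments ubounded : clear implicits.
Arguments uinfinitesimal : clear implicits.

Definition unif_bounded (X Y : nat -> normedModType R)
    (F : forall n, X n -> Y n) : Prop :=
  exists C : R, forall n x, `|F n x| <= C * `|x|.

Section Map.
Variables (X Y : nat -> normedModType R) (F : forall n, {additive X n -> Y n}).

Lemma umap_is_zmod_morphism :
  zmod_morphism (umap F : uprod omega (fun n => X n) -> uprod omega (fun n => Y n)).
Proof.
move=> x y; rewrite -[x]ureprK -[y]ureprK uclassB !umapE uclassB.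
by congr uclass; apply: functional_extensionality_dep => n; rewrite raddfB.
Qed.
HB.instance Definition _ :=
  GRing.isZmodMorphism.Build _ _ _ umap_is_zmod_morphism.

Hypothesis hF : unif_bounded F.

Lemma unif_boundedW : exists2 C : R, 0 < C & forall n x, `|F n x| <= C * `|x|.
Proof.
have [C hC] := hF; exists (`|C| + 1); first by rewrite ltr_wpDl.
move=> n x; rewrite (le_trans (hC n x))// ler_wpM2r// (le_trans (ler_norm _))//.
by rewrite lerDl.
Qed.

Lemma umap_ubounded (x : uprod omega (fun n => X n)) : x \in ubounded X -> umap F x \in ubounded Y.
Proof.
rewrite -[x]ureprK umapE => /uboundedP[M hM]; apply/uboundedP.
have [C C0 hC] := unif_boundedW.
exists (C * M); near=> n; rewrite (le_trans (hC n _))// ler_pM2l//.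
by near: n.
Unshelve. all: by end_near. Qed.

Lemma umap_uinfinitesimal (x : uprod omega (fun n => X n)) :
  x \in uinfinitesimal X -> umap F x \in uinfinitesimal Y.
Proof.
rewrite -[x]ureprK umapE => /uinfinitesimalP h; apply/uinfinitesimalP => e e0.
have [C C0 hC] := unif_boundedW.
have {}h := h _ (divr_gt0 e0 C0); near=> n.
rewrite (le_lt_trans (hC n _))// mulrC -ltr_pdivlMr//.
by near: n.
Unshelve. all: by end_near. Qed.

Definition tilde_map : tilde X -> tilde Y :=
  subquot_map (uinfinitesimal Y) umap_ubounded.

Lemma tilde_mapE x (xb : x \in ubounded X) :
  tilde_map (sqclass (uinfinitesimal X) xb) =
  sqclass (uinfinitesimal Y) (umap_ubounded xb).
Proof. by apply: subquot_mapE; exact: umap_uinfinitesimal. Qed.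

Lemma tilde_map_is_zmod_morphism : zmod_morphism tilde_map.
Proof. by apply: subquot_map_is_zmod_morphism; exact: umap_uinfinitesimal. Qed.
HB.instance Definition _ :=
  GRing.isZmodMorphism.Build _ _ _ tilde_map_is_zmod_morphism.

End Map.

Lemma tilde_map_near (X Y : nat -> normedModType R)
    (F F' : forall n, {additive X n -> Y n})
    (hF : unif_bounded F) (hF' : unif_bounded F') :
  (\forall n \near npuf omega, F n =1 F' n) ->
  tilde_map hF =1 tilde_map hF'.
Proof.
move=> FF' x; rewrite -[x]sqreprK !tilde_mapE; apply/sqclassP.
by rewrite (umap_near FF') subrr rpred0.
Qed.

Lemma tilde_map_square (X Y Y' Z : nat -> normedModType R)
    (F : forall n, {additive X n -> Y n}) (K : forall n, {additive Y n -> Z n})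
    (F' : forall n, {additive X n -> Y' n})
    (K' : forall n, {additive Y' n -> Z n})
    (hF : unif_bounded F) (hK : unif_bounded K)
    (hF' : unif_bounded F') (hK' : unif_bounded K') :
  (\forall n \near npuf omega, forall x, K n (F n x) = K' n (F' n x)) ->
  forall x, tilde_map hK (tilde_map hF x) = tilde_map hK' (tilde_map hF' x).
Proof.
move=> E x.
have KF r : umap K (umap F r) = umap K' (umap F' r) :> uprod omega Z.
  rewrite -[r]ureprK !umapE; apply/uclassP; near=> n.
  by have : forall x, K n (F n x) = K' n (F' n x) by near: n.
by rewrite -[x]sqreprK !tilde_mapE; apply/sqclassP; rewrite KF subrr rpred0.
Unshelve. all: by end_near. Qed.

End Tilde.
Arguments ubounded {R} omega X _.
Arguments uinfinitesimal {R} omega X _.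

Section BoundedFunctions.
Variables (R : realType) (X : Type) (V : normedModType R).

Definition bounded_fct : {pred X -> V} :=
  fun f => `[< exists M : R, forall x, `|f x| <= M >].

Lemma bounded_fct_submod_closed : submod_closed bounded_fct.
Proof.
split=> [|a f g /asboolP[M hM] /asboolP[N hN]]; apply/asboolP.
  by exists 0 => x; rewrite normr0.
exists (`|a| * M + N) => x; rewrite (le_trans (ler_normD _ _))// lerD//.
by rewrite normrZ ler_wpM2l.
Qed.
HB.instance Definition _ :=
  GRing.isSubmodClosed.Build R (X -> V) bounded_fct bounded_fct_submod_closed.

(* Bounded functions X -> V, with the sup norm. *)
Record linf := Linf { linf_val : X -> V; linf_valP : linf_val \in bounded_fct }.
HB.instance Definition _ := [isSub for linf_val].
HB.instance Definition _ := [Choice of linf by <:].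
HB.instance Definition _ := [SubChoice_isSubLmodule of linf by <:].

Definition fct_of_linf (f : linf) : X -> V := linf_val f.
Coercion fct_of_linf : linf >-> Funclass.

Definition linf_norm (f : linf) : R := sup (range (fun x => `|f x|)).

Lemma linf_bounded (f : linf) : has_ubound (range (fun x => `|f x|)).
Proof.
by have /asboolP[M hM] := linf_valP f; exists M => _ [x _ <-]; exact: hM.
Qed.

Lemma le_linf_norm (f : linf) x : `|f x| <= linf_norm f.
Proof. by apply: ub_le_sup; [exact: linf_bounded | exists x]. Qed.

Lemma linf_norm_le (f : linf) (M : R) :
  0 <= M -> (forall x, `|f x| <= M) -> linf_norm f <= M.
Proof.
move=> M0 hM; have [[_ [x _ _]]|/set0P/negP/negPn/eqP E] :=
  pselect (range (fun x => `|f x|) !=set0).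
  by apply: ge_sup; [exists `|f x|; exists x | move=> _ [y _ <-]].
by rewrite /linf_norm E sup0.
Qed.

Lemma linf_norm_ge0 (f : linf) : 0 <= linf_norm f.
Proof.
have [[_ [x _ _]]|/set0P/negP/negPn/eqP E] :=
  pselect (range (fun x => `|f x|) !=set0).
  by rewrite (le_trans (normr_ge0 (f x)))// le_linf_norm.
by rewrite /linf_norm E sup0.
Qed.

Lemma linfP (f g : linf) : (forall x, f x = g x) -> f = g.
Proof. by move=> fg; apply/val_inj/funext. Qed.

Lemma linfD (f g : linf) x : (f + g) x = f x + g x. Proof. by []. Qed.
Lemma linfZ (a : R) (f : linf) x : (a *: f) x = a *: f x. Proof. by []. Qed.

Lemma linf_normD (f g : linf) : linf_norm (f + g) <= linf_norm f + linf_norm g.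
Proof.
apply: linf_norm_le => [|x]; first by rewrite addr_ge0// linf_norm_ge0.
by rewrite linfD (le_trans (ler_normD _ _))// lerD// le_linf_norm.
Qed.

Lemma linf_normZ (a : R) (f : linf) : linf_norm (a *: f) = `|a| * linf_norm f.
Proof.
have le b g : linf_norm (b *: g) <= `|b| * linf_norm g.
  apply: linf_norm_le => [|x]; first by rewrite mulr_ge0// linf_norm_ge0.
  by rewrite linfZ normrZ ler_wpM2l// le_linf_norm.
apply/eqP; rewrite eq_le le /=.
have [->|a0] := eqVneq a 0; first by rewrite normr0 mul0r linf_norm_ge0.
rewrite -ler_pdivlMl ?normr_gt0// -normfV.
by rewrite (le_trans _ (le _ _))// scalerA mulVf// scale1r.
Qed.

Lemma linf_norm0_eq0 (f : linf) : linf_norm f = 0 -> f = 0.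
Proof.
move=> f0; apply: linfP => x; apply/eqP; rewrite -normr_le0 -f0.
exact: le_linf_norm.
Qed.

HB.instance Definition _ :=
  Lmodule_isNormed.Build R linf linf_normD linf_normZ linf_norm0_eq0.

End BoundedFunctions.
Arguments bounded_fct {R} X V _.

Section Pullback.
Variables (R : realType) (X Y : Type) (V : normedModType R) (u : X -> Y).

Lemma linf_pull_subproof (f : linf Y V) : f \o u \in bounded_fct X V.
Proof.
have /asboolP[M hM] := linf_valP f.
by apply/asboolP; exists M => x; exact: hM.
Qed.

Definition linf_pull (f : linf Y V) : linf X V := Linf (linf_pull_subproof f).

Lemma linf_pull_is_linear : linear linf_pull.
Proof. by move=> a f g; apply: linfP. Qed.
HB.instance Definition _ :=
  GRing.isLinear.Build R (linf Y V) (linf X V) _ _ linf_pull_is_linear.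

Lemma linf_pull_norm (f : linf Y V) : `|linf_pull f| <= `|f|.
Proof. by apply: linf_norm_le => [|x]; [exact: linf_norm_ge0 | exact: (le_linf_norm f)]. Qed.

End Pullback.

Section ContinuousDual.
Variables (R : realType) (V : normedModType R).

Definition cdual_pred : {pred V -> R^o} :=
  fun l => `[< linear l /\ continuous l >].

Lemma cdual_submod_closed : submod_closed cdual_pred.
Proof.
split=> [|a l k /asboolP[ll lc] /asboolP[kl kc]]; apply/asboolP; split.
- by move=> a u v; rewrite /= scaler0 addr0.
- by move=> x; exact: cvg_cst.
- move=> b u v; rewrite !fctE ll kl !scalerDr !scalerA [b * a]mulrC.
  by rewrite addrACA.
- by move=> x; apply: cvgD; [apply: cvgZr; exact: lc | exact: kc].
Qed.
HB.instance Definition _ :=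
  GRing.isSubmodClosed.Build R (V -> R^o) cdual_pred cdual_submod_closed.

(* The continuous dual with the operator norm. *)
Record cdual := Cdual { cdual_val : V -> R^o; cdual_valP : cdual_val \in cdual_pred }.
HB.instance Definition _ := [isSub for cdual_val].
HB.instance Definition _ := [Choice of cdual by <:].
HB.instance Definition _ := [SubChoice_isSubLmodule of cdual by <:].

Definition fct_of_cdual (l : cdual) : V -> R^o := cdual_val l.
Coercion fct_of_cdual : cdual >-> Funclass.

Definition cdual_norm (l : cdual) : R :=
  sup [set `|l v| | v in [set v : V | `|v| <= 1]].

Lemma cdual_linear (l : cdual) : linear l.
Proof. by have /asboolP[] := cdual_valP l. Qed.

Lemma cdual_continuous (l : cdual) : continuous l.
Proof. by have /asboolP[] := cdual_valP l. Qed.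

HB.instance Definition _ (l : cdual) :=
  GRing.isLinear.Build R V R^o _ (fct_of_cdual l) (@cdual_linear l).

Lemma cdualP (l k : cdual) : (forall v, l v = k v) -> l = k.
Proof. by move=> lk; apply/val_inj/funext. Qed.

Lemma cdual_has_sup (l : cdual) :
  has_sup [set `|l v| | v in [set v : V | `|v| <= 1]].
Proof.
split; first by exists `|l 0|; exists 0 => //=; rewrite normr0.
have /linear_boundedP/pinfty_ex_gt0[M M0 hM] :
  bounded_near (l : {linear V -> R^o}) (nbhs 0).
  by apply/linear_bounded_continuous; exact: cdual_continuous.
exists M => _ [v /= v1 <-]; rewrite (le_trans (hM v))//.
by rewrite ler_piMr// ltW.
Qed.

Lemma cdual_norm_ge0 (l : cdual) : 0 <= cdual_norm l.
Proof.
rewrite (le_trans (normr_ge0 (l 0)))//.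
apply: ub_le_sup; first by case: (cdual_has_sup l).
by exists 0 => //=; rewrite normr0.
Qed.

Lemma le_cdual_norm (l : cdual) v : `|l v| <= cdual_norm l * `|v|.
Proof.
have [->|v0] := eqVneq v 0; first by rewrite linear0 !normr0 mulr0.
rewrite -ler_pdivrMr ?normr_gt0//.
apply: ub_le_sup; first by case: (cdual_has_sup l).
exists (`|v|^-1 *: v).
  by rewrite /= normrZ normfV normr_id mulVf ?normr_eq0.
by rewrite linearZ/= normrM normfV normr_id mulrC.
Qed.

Lemma cdual_norm_le (l : cdual) (M : R) :
  (forall v, `|v| <= 1 -> `|l v| <= M) -> cdual_norm l <= M.
Proof.
move=> hM; apply: ge_sup; first by case: (cdual_has_sup l).
by move=> _ [v v1 <-]; exact: hM.
Qed.

Lemma cdual_normD (l k : cdual) :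
  cdual_norm (l + k) <= cdual_norm l + cdual_norm k.
Proof.
apply: cdual_norm_le => v v1.
rewrite (le_trans (ler_normD (l v) (k v)))// lerD//.
  by rewrite (le_trans (le_cdual_norm _ _))// ler_piMr// cdual_norm_ge0.
by rewrite (le_trans (le_cdual_norm _ _))// ler_piMr// cdual_norm_ge0.
Qed.

Lemma cdual_normZ (a : R) (l : cdual) :
  cdual_norm (a *: l) = `|a| * cdual_norm l.
Proof.
have le b g : cdual_norm (b *: g) <= `|b| * cdual_norm g.
  apply: cdual_norm_le => v v1; rewrite [X in `|X|](_ : _ = b * g v)//.
  rewrite normrM ler_wpM2l// (le_trans (le_cdual_norm _ _))//.
  by rewrite ler_piMr// cdual_norm_ge0.
apply/eqP; rewrite eq_le le /=.
have [->|a0] := eqVneq a 0; first by rewrite normr0 mul0r cdual_norm_ge0.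
rewrite -ler_pdivlMl ?normr_gt0// -normfV.
by rewrite (le_trans _ (le _ _))// scalerA mulVf// scale1r.
Qed.

Lemma cdual_norm0_eq0 (l : cdual) : cdual_norm l = 0 -> l = 0.
Proof.
move=> l0; apply: cdualP => v; apply/eqP; rewrite -normr_le0.
by rewrite (le_trans (le_cdual_norm _ _))// l0 mul0r.
Qed.

HB.instance Definition _ :=
  Lmodule_isNormed.Build R cdual cdual_normD cdual_normZ cdual_norm0_eq0.

End ContinuousDual.
Arguments cdual_pred {R} V _.

Section Coamenability.
Variables (R : realType) (G : groupType) (S : groupClosed G).

Definition coset_rel (x y : G) : bool := (x^-1 * y)%g \in S.

Lemma coset_rel_equiv : equiv_class_of coset_rel.
Proof.
split=> [x|x y|y x z]; rewrite /coset_rel.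
- by rewrite mulVg gpred1.
- by rewrite -gpredV invgM invgK.
- by move=> xy yz; rewrite -(mulgK y x^-1%g) -mulgA gpredM.
Qed.
Canonical coset_rel_equivrel := EquivRelPack coset_rel_equiv.
Canonical coset_rel_encModRel := defaultEncModRel coset_rel.

(* G / S: the left cosets x S, as x ~ y iff x^-1 y is in S. *)
Definition lcoset_space : Type := {eq_quot coset_rel}.
HB.instance Definition _ : EqQuotient G coset_rel lcoset_space :=
  EqQuotient.on lcoset_space.

Definition lcoset_act (g : G) (c : lcoset_space) : lcoset_space :=
  \pi_lcoset_space (g * repr c)%g.

Lemma lcoset_actE (g x : G) :
  lcoset_act g (\pi_lcoset_space x) = \pi_lcoset_space (g * x)%g.
Proof.
apply/eqP; rewrite piE /coset_rel invgM -mulgA mulKg.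
by rewrite -/(coset_rel _ _) -(@eqquotE _ _ lcoset_space) reprK.
Qed.

Lemma linf_one_subproof (X : Type) :
  (fun _ : X => 1 : R^o) \in bounded_fct X R^o.
Proof. by apply/asboolP; exists 1 => x; rewrite normr1. Qed.
Definition linf_one (X : Type) : linf X R^o := Linf (linf_one_subproof X).

Definition coamenable : Prop :=
  exists m : {linear linf lcoset_space R^o -> R^o},
    [/\ m (linf_one lcoset_space) = 1,
        forall f, `|m f| <= `|f|
      & forall g f, m (linf_pull (lcoset_act g^-1%g) f) = m f].

End Coamenability.

Section AsymptoticModules.
Variables (R : realType) (omega : npUltrafilter) (G : groupType).

(* The sequence of maps inducing the internal map of an asymptotic module. *)
Record isomRep := IsomRep {
  rep_space : nat -> completeNormedModType R;
  rep_act : forall n, G -> {linear rep_space n -> rep_space n};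
  rep_act_isom : forall n g v, `|rep_act n g v| = `|v| }.

Section TildeAct.
Variables (E : isomRep) (g : star omega G).

Lemma act_unif_bounded :
  unif_bounded (fun n => rep_act E n (urepr g n) : rep_space E n -> rep_space E n).
Proof. by exists 1 => n v; rewrite rep_act_isom mul1r. Qed.

(* The map induced by g on the bounded-modulo-infinitesimal quotient. It is
   additive, homogeneous and isometric because each rep_act n is. *)
Definition tilde_act :
    tilde omega (fun n => rep_space E n) -> tilde omega (fun n => rep_space E n) :=
  tilde_map act_unif_bounded.

End TildeAct.
Arguments tilde_act : clear implicits.

Record asympModule := AsympModule {
  asymp_rep :> isomRep;
  tilde_act1 : forall v, tilde_act asymp_rep 1%g v = v;
  tilde_actM : forall g h v,
    tilde_act asymp_rep (g * h)%g v = tilde_act asymp_rep g (tilde_act asymp_rep h v) }.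

Section Contragredient.
Variables (E : isomRep) (n : nat) (g : G).

Lemma contragredient_subproof (l : cdual (rep_space E n)) :
  l \o rep_act E n g^-1%g \in cdual_pred (rep_space E n).
Proof.
apply/asboolP; split=> [a u v|x]; first by rewrite /= !linearP.
apply: continuous_comp; last exact: cdual_continuous.
apply: bounded_linear_continuous; apply/linear_boundedP.
by near=> r => v; rewrite rep_act_isom ler_peMl//; near: r; exact: nbhs_pinfty_ge.
Unshelve. all: by end_near. Qed.

Definition contragredient (l : cdual (rep_space E n)) : cdual (rep_space E n) :=
  Cdual (contragredient_subproof l).

End Contragredient.

(* The module only depends on the data up to equality on a set in omega, hence
   the identification with the internal dual is asked on such a set. *)
Definition dual_asympModule (V : asympModule) : Prop :=
  exists W : asympModule, \forall n \near npuf omega,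
    exists T : {linear rep_space V n -> cdual (rep_space W n)},
      [/\ bijective T, forall v, `|T v| = `|v|
        & forall g v, T (rep_act V n g v) = contragredient g (T v)].

End AsymptoticModules.
Arguments tilde_act {R omega G} E g _.

Section Cohomology.
Variables (R : realType) (omega : npUltrafilter) (G : groupType).
Variable V : asympModule R omega G.

(* The n-th component of the internal cochains in m variables: bounded
   functions of (g_1, ..., g_m), or (g_0, ..., g_(m-1)). *)
Definition cochain (m n : nat) : normedModType R :=
  linf ('I_m -> G) (rep_space V n).

Definition tcochain (m : nat) : zmodType := tilde omega (cochain m).

Section Action.
Variables m n : nat.

Lemma cochain_act_subproof (g : G) (f : cochain m n) :
  (fun x : 'I_m -> G => rep_act V n g (f (fun i => g^-1 * x i)%g))
    \in bounded_fct ('I_m -> G) (rep_space V n).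
Proof.
have /asboolP[M hM] := linf_valP f.
by apply/asboolP; exists M => x; rewrite rep_act_isom; exact: hM.
Qed.

Definition cochain_act (g : G) (f : cochain m n) : cochain m n :=
  Linf (cochain_act_subproof g f).

Lemma cochain_act_is_linear g : linear (cochain_act g).
Proof. by move=> a f h; apply: linfP => x; rewrite /= linearP. Qed.
HB.instance Definition _ g :=
  GRing.isLinear.Build R (cochain m n) (cochain m n) _ _
    (cochain_act_is_linear g).

Lemma cochain_act_norm g f : `|cochain_act g f| <= `|f|.
Proof.
apply: linf_norm_le => [|x]; first exact: linf_norm_ge0.
by rewrite rep_act_isom; exact: (le_linf_norm f).
Qed.

(* x \o lift j is x with its j-th entry omitted. *)
Definition cobound (f : cochain m n) : cochain m.+1 n :=
  \sum_(j < m.+1) (-1) ^+ j *: linf_pull (fun x : 'I_m.+1 -> G => x \o lift j) f.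

Lemma cobound_is_linear : linear cobound.
Proof.
move=> a f h; rewrite /cobound scaler_sumr -big_split; apply: eq_bigr => j _.
by rewrite linearP scalerDr !scalerA mulrC.
Qed.
HB.instance Definition _ :=
  GRing.isLinear.Build R (cochain m n) (cochain m.+1 n) _ _ cobound_is_linear.

Lemma cobound_norm f : `|cobound f| <= m.+1%:R * `|f|.
Proof.
rewrite (le_trans (ler_norm_sum _ _ _))// mulr_natl -[X in _ *+ X]card_ord.
rewrite -sumr_const ler_sum// => j _.
by rewrite normrZ normrX normrN1 expr1n mul1r linf_pull_norm.
Qed.

End Action.

Lemma cobound_cobound m n (f : cochain m n) : cobound (cobound f) = 0.
Proof.
pose F (p : 'I_m.+2 * 'I_m.+1) : cochain m.+2 n :=
  (-1) ^+ (p.1 + p.2) *: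
    linf_pull (fun x : 'I_m.+2 -> G => (x \o lift p.1) \o lift p.2) f.
have -> : cobound (cobound f) = \sum_p F p.
  rewrite (eq_bigr (fun p => F (p.1, p.2))) => [|[]//].
  rewrite -(pair_bigA _ (fun j i => F (j, i))) /=; apply: eq_bigr => j _.
  rewrite raddf_sum scaler_sumr; apply: eq_bigr => i _.
  by rewrite /F exprD -scalerA; apply: linfP.
rewrite (bigID (fun p : 'I_m.+2 * 'I_m.+1 => p.2 < p.1)%N) /=.
pose h (p : 'I_m.+2 * 'I_m.+1) : 'I_m.+2 * 'I_m.+1 :=
  (widen_ord (leqnSn _) p.2, inord p.1.-1).
pose k (p : 'I_m.+2 * 'I_m.+1) : 'I_m.+2 * 'I_m.+1 :=
  (lift ord0 p.2, inord p.1).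
rewrite [X in _ + X](reindex_onto h k) => [|[j i]]; last first.
  rewrite -leqNgt /h /k /= => ji; congr (_, _); apply: val_inj => /=.
    by rewrite inordK// (leq_ltn_trans ji).
  by rewrite add0n inord_val.
rewrite [X in _ + X](eq_bigl (fun p : 'I_m.+2 * 'I_m.+1 => p.2 < p.1)%N).
  rewrite -big_split big1// => -[[[|j] jm] i]//= ij.
  rewrite /F /h /= inordK// addSn exprS mulN1r [(i + j)%N]addnC scaleNr.
  apply/eqP; rewrite addrC subr_eq0; apply/eqP; congr (_ *: _); apply: linfP => x /=.
  congr (f _); apply/funext => l; congr (x _); apply: val_inj => /=.
  by rewrite /bump inordK//; move: ij; rewrite ltnS; lia.
move=> [j i]; rewrite /h /k /= -leqNgt.
have jE : (inord j.-1 : 'I_m.+1) = j.-1 :> nat.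
  by rewrite inordK //; have := ltn_ord j; lia.
rewrite jE xpair_eqE -!val_eqE /= jE /bump /= inord_val eqxx andbT.
by apply/andP/idP => [[ij /eqP]|ij]; [|split]; lia.
Qed.

Lemma cochain_act_unif_bounded m (g : star omega G) :
  unif_bounded (fun n => @cochain_act m n (urepr g n)).
Proof. by exists 1 => n f; rewrite mul1r cochain_act_norm. Qed.

Definition tcochain_act m (g : star omega G) : tcochain m -> tcochain m :=
  tilde_map (cochain_act_unif_bounded m g).

Lemma cobound_unif_bounded m : unif_bounded (@cobound m).
Proof. by exists m.+1%:R => n f; exact: cobound_norm. Qed.

Definition tcobound m : tcochain m -> tcochain m.+1 :=
  tilde_map (cobound_unif_bounded m).

Definition invariant m (f : tcochain m) : Prop :=
  forall g, tcochain_act g f = f.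

(* Degree n is carried by functions of n.+1 variables. The complex starts with
   0 -> functions of one variable, so in degree 0 the only coboundary is 0 (and
   not a coboundary of functions of no variable). *)
Definition cocycle (n : nat) : {pred tcochain n.+1} :=
  fun f => `[< invariant f /\ tcobound f = 0 >].

Definition coboundary (n : nat) : {pred tcochain n.+1} :=
  match n with
  | 0 => fun f => f == 0
  | k.+1 => fun f => `[< exists2 h : tcochain k.+1, invariant h & f = tcobound h >]
  end.

Arguments cocycle : clear implicits.
Arguments coboundary : clear implicits.

Lemma tcobound_invariant m (f : tcochain m) :
  invariant f -> invariant (tcobound f).
Proof.
move=> fi g; rewrite -[in RHS](fi g); apply: tilde_map_square; near=> n => x.
rewrite /cobound raddf_sum; apply: eq_bigr => j _.
apply: linfP => y; exact: linearZ_LR.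
Unshelve. all: by end_near. Qed.

Lemma coboundary_sub_cocycle n : {subset coboundary n <= cocycle n}.
Proof.
case: n => [|k] f.
  by move=> /eqP ->; apply/asboolP; split=> [g|]; rewrite /tcochain_act /tcobound raddf0.
move=> /asboolP[h hi ->]; apply/asboolP; split; first exact: tcobound_invariant.
have dd r : umap (@cobound k.+2) (umap (@cobound k.+1) r) = 0
    :> uprod omega (fun n => cochain k.+3 n).
  rewrite -[r]ureprK !umapE; congr uclass.
  by apply: functional_extensionality_dep => n; exact: cobound_cobound.
rewrite -[h]sqreprK /tcobound !tilde_mapE -[RHS]sqclass0.
by apply/sqclassP; rewrite subr0; rewrite [X in X \in _]dd rpred0.
Qed.

Lemma cocycle_zmod_closed n : zmod_closed (cocycle n).
Proof.
split=> [|f h /asboolP[fi fd] /asboolP[hi hd]]; apply/asboolP; split.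
- by move=> g; rewrite /tcochain_act raddf0.
- by rewrite /tcobound raddf0.
- by move=> g; rewrite /tcochain_act raddfB; congr (_ - _); [exact: fi|exact: hi].
- by rewrite /tcobound raddfB [X in X - _]fd [X in _ - X]hd subrr.
Qed.
HB.instance Definition _ n :=
  GRing.isZmodClosed.Build (tcochain n.+1) (cocycle n) (cocycle_zmod_closed n).

Lemma coboundary_zmod_closed n : zmod_closed (coboundary n).
Proof.
case: n => [|k]; split.
- exact: eqxx.
- by move=> f h /eqP -> /eqP ->; rewrite subrr; exact: eqxx.
- apply/asboolP; exists 0; last by rewrite /tcobound raddf0.
  by move=> g; rewrite /tcochain_act raddf0.
- move=> _ _ /asboolP[f fi ->] /asboolP[h hi ->]; apply/asboolP.
  exists (f - h); last by rewrite /tcobound raddfB.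
  by move=> g; rewrite /tcochain_act raddfB; congr (_ - _); [exact: fi|exact: hi].
Qed.
HB.instance Definition _ n :=
  GRing.isZmodClosed.Build (tcochain n.+1) (coboundary n)
    (coboundary_zmod_closed n).

Definition acohomology (n : nat) : zmodType := subquot (cocycle n) (coboundary n).

End Cohomology.
Arguments cocycle {R omega G} V n _.
Arguments coboundary {R omega G} V n _.

Section Restriction.
Variables (R : realType) (omega : npUltrafilter) (G : groupType).
Variables (S : groupClosed G) (L : subGroupType (fun x : G => x \in S)).
Variable V : asympModule R omega G.

Definition res_rep : isomRep R L :=
  @IsomRep R L (rep_space (asymp_rep V)) (fun n l => rep_act V n (\val l))
    (fun n l v => rep_act_isom (\val l) v).

Definition star_val : star omega L -> star omega G :=
  umap (fun _ (l : L) => \val l).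

Lemma star_val1 : star_val 1%g = 1%g.
Proof.
by rewrite /star_val [1%g in LHS]/1%g umapE; congr uclass; apply/funext => n; rewrite val1.
Qed.

Lemma star_valM l k : star_val (l * k)%g = (star_val l * star_val k)%g.
Proof.
rewrite -[l]ureprK -[k]ureprK /star_val [X in umap _ X]umap2E !umapE.
by rewrite [RHS]umap2E; congr uclass; apply/funext => n; rewrite valM.
Qed.

Lemma res_tilde_act l v : tilde_act res_rep l v = tilde_act V (star_val l) v.
Proof.
apply: tilde_map_near; near=> n => x /=.
have -> : urepr (star_val l) n = \val (urepr l n) by near: n; exact: urepr_class.
by [].
Unshelve. all: by end_near. Qed.

Lemma res_tilde_act1 v : tilde_act res_rep (1%g : star omega L) v = v.
Proof. by rewrite res_tilde_act star_val1 tilde_act1. Qed.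

Lemma res_tilde_actM (l k : star omega L) v :
  tilde_act res_rep (l * k)%g v =
  tilde_act res_rep l (tilde_act res_rep k v).
Proof. by rewrite !res_tilde_act star_valM tilde_actM. Qed.

Definition res_module : asympModule R omega L :=
  AsympModule res_tilde_act1 res_tilde_actM.

Definition res_cochain m n : cochain V m n -> cochain res_module m n :=
  linf_pull (fun (x : 'I_m -> L) i => \val (x i)).
HB.instance Definition _ m n := GRing.Linear.on (@res_cochain m n).

Lemma res_cochain_unif_bounded m : unif_bounded (@res_cochain m).
Proof. by exists 1 => n f; rewrite mul1r linf_pull_norm. Qed.

Definition tres m : tcochain V m -> tcochain res_module m :=
  tilde_map (res_cochain_unif_bounded m).

Lemma tres_act m (l : star omega L) (f : tcochain V m) :
  tres (tcochain_act (star_val l) f) = tcochain_act l (tres f).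
Proof.
apply: tilde_map_square; near=> n => x; apply: linfP => y /=.
have -> : urepr (star_val l) n = \val (urepr l n) by near: n; exact: urepr_class.
congr (rep_act _ _ _ (x _)); apply/funext => i.
by rewrite valM gmulfV.
Unshelve. all: by end_near. Qed.

Lemma tres_cobound m (f : tcochain V m) :
  tres (tcobound f) = tcobound (tres f).
Proof.
apply: tilde_map_square; near=> n => x; rewrite /cobound /res_cochain raddf_sum.
by apply: eq_bigr => j _; apply: linfP.
Unshelve. all: by end_near. Qed.

Lemma tres_invariant m (f : tcochain V m) : invariant f -> invariant (tres f).
Proof. by move=> fi l; rewrite -tres_act fi. Qed.

Lemma tres_cocycle n (f : tcochain V n.+1) :
  f \in cocycle V n -> tres f \in cocycle res_module n.
Proof.
move=> /asboolP[fi fd]; apply/asboolP; split; first exact: tres_invariant.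
by rewrite -tres_cobound fd /tres raddf0.
Qed.

Lemma tres_coboundary n (f : tcochain V n.+1) :
  f \in coboundary V n -> tres f \in coboundary res_module n.
Proof.
case: n f => [|k] f; first by move=> /eqP ->; apply/eqP; rewrite /tres raddf0.
move=> /asboolP[h hi ->]; apply/asboolP; exists (tres h).
  exact: tres_invariant.
exact: tres_cobound.
Qed.

Definition restriction (n : nat) : acohomology V n -> acohomology res_module n :=
  subquot_map (coboundary res_module n) (@tres_cocycle n).

Lemma restriction_is_zmod_morphism n : zmod_morphism (@restriction n).
Proof. by apply: subquot_map_is_zmod_morphism; exact: tres_coboundary. Qed.
HB.instance Definition _ n :=
  GRing.isZmodMorphism.Build _ _ _ (@restriction_is_zmod_morphism n).

End Restriction.

(* Main.v *)
(** Let r : Gamma -> Lambda satisfy r (l x) = l (r x) for l in Lambda. Pulling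
    back along r inflates cochains of Lambda to Lambda-invariant cochains on
    Gamma, and the prism operator K built from r gives f - infl (res f) = d (K
    f) + K (d f). Hence if f is a cocycle and res f = d h, then f = d h' with
    h' invariant under Lambda only. Averaging the translates of h' over Gamma
    / Lambda with the invariant mean, applied weak-* in the dual module,
    commutes with d, fixes f, and turns h' into a Gamma-invariant cochain. The
    averaging involves all cosets at once, so it needs asymptotic identities
    to hold uniformly in the group elements; they do, because they hold for
    internal sequences of worst elements. *)

Require Import Defs.
From HB Require Import structures.
From mathcomp Require Import all_boot all_order all_algebra.
From mathcomp Require Import all_classical all_reals all_analysis.
From mathcomp Require Import zify lra.
Import numFieldNormedType.Exports.

Set Implicit Arguments.
Unset Strict Implicit.
Unset Printing Implicit Defensive.

Import Order.TTheory GRing.Theory Num.Theory.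

Local Open Scope classical_set_scope.
Local Open Scope quotient_scope.
Local Open Scope ring_scope.

(** * Classes modulo infinitesimals, computed on sequences *)

Lemma sqclassB (A : zmodType) (Z B : zmodClosed A) x y
    (xZ : x \in Z) (yZ : y \in Z) :
  sqclass B xZ - sqclass B yZ = sqclass B (rpredB xZ yZ).
Proof.
rewrite /sqclass -raddfB; congr (\pi_{ideal_quot _} _).
by apply/val_inj; rewrite raddfB.
Qed.

Section TildeMaps.
Variables (R : realType) (omega : npUltrafilter).

(* Take for [a n] a counterexample to [P n] whenever there is one. *)
Lemma near_forall (A : nat -> Type) (P : forall n, A n -> Prop) :
  (forall n, inhabited (A n)) ->
  (forall a : forall n, A n, \forall n \near npuf omega, P n (a n)) ->
  \forall n \near npuf omega, forall a, P n a.
Proof.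
move=> A0 h.
have b n : {b : A n | (exists a, ~ P n a) -> ~ P n b}.
  apply: cid; have [[a Pa]|nP] := pselect (exists a, ~ P n a).
    by exists a.
  by have [a] := A0 n; exists a.
have hb := h (fun n => sval (b n)); near=> n.
have : P n (sval (b n)) by near: n.
move=> Pb a; apply: contrapT => Pa.
by case: (svalP (b n) (ex_intro _ a Pa)).
Unshelve. all: by end_near. Qed.

Lemma tildeP (X : nat -> normedModType R) (x y : forall n, X n)
    (xb : uclass omega x \in ubounded omega X)
    (yb : uclass omega y \in ubounded omega X) :
  sqclass (uinfinitesimal omega X) xb = sqclass (uinfinitesimal omega X) yb <->
  forall e : R, 0 < e -> \forall n \near npuf omega, `|x n - y n| < e.
Proof.
split=> [/sqclassP|h]; first by rewrite uclassB => /uinfinitesimalP.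
by apply/sqclassP; rewrite uclassB; apply/uinfinitesimalP.
Qed.

Lemma uboundedB (X : nat -> normedModType R) (x y : forall n, X n) :
  uclass omega x \in ubounded omega X -> uclass omega y \in ubounded omega X ->
  uclass omega (fun n => x n - y n) \in ubounded omega X.
Proof. by move=> xb yb; rewrite -uclassB rpredB. Qed.

Lemma tildeB (X : nat -> normedModType R) (x y : forall n, X n)
    (xb : uclass omega x \in ubounded omega X)
    (yb : uclass omega y \in ubounded omega X) :
  sqclass (uinfinitesimal omega X) xb - sqclass (uinfinitesimal omega X) yb =
  sqclass (uinfinitesimal omega X) (uboundedB xb yb).
Proof. by rewrite sqclassB; apply/sqclassP; rewrite (uclassB omega x y) subrr rpred0. Qed.

Lemma tilde_ex (X : nat -> normedModType R) (f : tilde omega X) :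
  exists (x : forall n, X n) (xb : uclass omega x \in ubounded omega X),
    f = sqclass (uinfinitesimal omega X) xb.
Proof.
have xb : uclass omega (urepr (sqrepr f)) \in ubounded omega X.
  by rewrite ureprK; exact: sqreprP.
exists (urepr (sqrepr f)), xb; rewrite -[LHS]sqreprK.
by apply/sqclassP; rewrite ureprK subrr rpred0.
Qed.

Section OneMap.
Variables (X Y : nat -> normedModType R).
Variables (F : forall n, {additive X n -> Y n}) (hF : unif_bounded F).

Lemma ubounded_map (x : forall n, X n) :
  uclass omega x \in ubounded omega X ->
  uclass omega (fun n => F n (x n)) \in ubounded omega Y.
Proof. by move=> xb; have := umap_ubounded hF xb; rewrite umapE. Qed.

Lemma tilde_map_class (x : forall n, X n)
    (xb : uclass omega x \in ubounded omega X) :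
  tilde_map hF (sqclass (uinfinitesimal omega X) xb) =
  sqclass (uinfinitesimal omega Y) (ubounded_map xb).
Proof. by rewrite tilde_mapE; apply/sqclassP; rewrite umapE subrr rpred0. Qed.

End OneMap.
End TildeMaps.

(** * The prism operator and its homotopy formula *)

(* The faces i and i.+1 of the i-th prism simplex telescope; the others are
   prism simplices of faces, and cancel against the second sum. *)
Lemma prism_telescope (R : pzRingType) (U : lmodType R) (m : nat)
    (A B : nat -> nat -> U) (q : nat -> U) :
  (forall i j, (j <= i)%N -> B i.+1 j = A i j) ->
  (forall i, B i i = q i) ->
  (forall i, B i i.+1 = q i.+1) ->
  (forall i j, (i < j)%N -> B i j.+1 = A i j) ->
  \sum_(0 <= i < m.+1) \sum_(0 <= j < m.+2) (-1) ^+ (i + j) *: B i j +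
  \sum_(0 <= i < m) \sum_(0 <= j < m.+1) (-1) ^+ (i + j) *: A i j =
  q 0 - q m.+1.
Proof.
move=> Bl Bd Bd' Br.
(* Row [i] of the first sum splits at the diagonal: [L i] lies before it, the entries [i] and [i.+1]
   give [q i - q i.+1], and the rest, shifted by one column, is [- M i]. *)
pose L i := \sum_(0 <= j < i) (-1) ^+ (i + j) *: B i j.
pose M i := \sum_(i.+1 <= j < m.+1) (-1) ^+ (i + j) *: A i j.
have row i : (i < m.+1)%N ->
    \sum_(0 <= j < m.+2) (-1) ^+ (i + j) *: B i j = L i - M i - (q i.+1 - q i).
  move=> im; rewrite (big_cat_nat (n := i))//=; last by lia.
  rewrite [X in _ + X]big_ltn; last by lia.
  rewrite [X in _ + (_ + X)]big_ltn; last by lia.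
  rewrite Bd Bd' addnS exprS addnn -mul2n exprM sqrrN expr1n expr1n scale1r.
  rewrite mulr1 scaleN1r opprB -addrA; congr (_ + _).
  rewrite addrA addrC; congr (_ + _).
  rewrite /M big_add1 /= -sumrN; apply: eq_big_nat => j /andP[ij _].
  by rewrite Br// addnS exprS mulN1r scaleNr.
rewrite (eq_big_nat _ _ (F2 := fun i => L i - M i - (q i.+1 - q i))); last first.
  by move=> i /andP[_ im]; exact: row.
(* [L 0] and [M m] are empty sums, so both sums can be indexed by [i < m] like the second double
   sum. *)
have LE : \sum_(0 <= i < m.+1) L i = \sum_(0 <= i < m) L i.+1.
  by rewrite big_nat_recl// [L 0]big_geq// add0r.
have ME : \sum_(0 <= i < m.+1) M i = \sum_(0 <= i < m) M i.
  by rewrite big_nat_recr//= [M m]big_geq// addr0.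
rewrite sumrB telescope_sumr// sumrB LE ME opprB addrAC -sumrB -big_split /=.
rewrite big1_seq ?add0r// => i; rewrite mem_index_iota/= => im.
(* In row [i] of the second sum, the entries with [j <= i] cancel [L i.+1] and the others cancel
   [- M i]. *)
rewrite [X in _ + X](big_cat_nat (n := i.+1))//=; last by lia.
rewrite -/(M i) addrA addrAC subrK /L -big_split big1_seq// => j.
rewrite mem_index_iota /= => ji.
by rewrite Bl// addSn exprS mulN1r scaleNr addNr.
Qed.

Lemma linf_sumE (R : realType) (X I : Type) (V : normedModType R) (s : seq I)
    (f : I -> linf X V) x : (\sum_(i <- s) f i) x = \sum_(i <- s) f i x.
Proof. by apply: (big_morph (fun g : linf X V => g x)). Qed.

Lemma le_linf (R : realType) (X : Type) (V : normedModType R) (f : linf X V) x :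
  `|f x| <= `|f|.
Proof. exact: (le_linf_norm f). Qed.

Lemma linf_le (R : realType) (X : Type) (V : normedModType R) (f : linf X V)
    (M : R) : 0 <= M -> (forall x, `|f x| <= M) -> `|f| <= M.
Proof. exact: linf_norm_le. Qed.

Section Prism.
Variables (R : realType) (omega : npUltrafilter) (G : groupType).
Variables (V : asympModule R omega G) (r : G -> G).

(* The value [1] past the end of [x] is never used. *)
Definition seq_of (m : nat) (x : 'I_m -> G) (l : nat) : G :=
  if insub l is Some k then x k else 1%g.

Lemma seq_ofE m (x : 'I_m -> G) (l : 'I_m) : seq_of x l = x l.
Proof. by rewrite /seq_of valK. Qed.

(** Vertex [l] of the [i]-th prism simplex [(r y_0, ..., r y_i, y_i, ..., y_(m-1))]. Taking [y] on
    all of [nat] keeps bounds out of the index computations. *)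
Definition prism_vertex (i : nat) (y : nat -> G) (l : nat) : G :=
  if (l <= i)%N then r (y l) else y l.-1.

Definition prism m n (f : cochain V m.+1 n) : cochain V m n :=
  \sum_(i < m) (-1) ^+ i *:
    linf_pull (fun x (l : 'I_m.+1) => prism_vertex i (seq_of x) l) f.

Lemma prism_is_linear m n : linear (@prism m n).
Proof.
move=> a f h; rewrite /prism scaler_sumr -big_split; apply: eq_bigr => j _.
by rewrite linearP scalerDr !scalerA mulrC.
Qed.
HB.instance Definition _ m n :=
  GRing.isLinear.Build R (cochain V m.+1 n) (cochain V m n) _ _
    (@prism_is_linear m n).

Lemma prism_norm m n (f : cochain V m.+1 n) : `|prism f| <= m%:R * `|f|.
Proof.
rewrite (le_trans (ler_norm_sum _ _ _))// mulr_natl -[X in _ *+ X]card_ord.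
rewrite -sumr_const ler_sum// => j _.
by rewrite normrZ normrX normrN1 expr1n mul1r linf_pull_norm.
Qed.

Lemma prism_unif_bounded m : unif_bounded (@prism m).
Proof. by exists m%:R => n f; exact: prism_norm. Qed.

Definition tprism m : tcochain V m.+1 -> tcochain V m :=
  tilde_map (prism_unif_bounded m).

Lemma seq_of_lift m (x : 'I_m.+1 -> G) (j : 'I_m.+1) l : (l < m)%N ->
  seq_of (x \o lift j) l = seq_of x (bump j l).
Proof.
move=> lm; rewrite -[l]/(val (Ordinal lm)) seq_ofE /=.
by rewrite -[bump j l]/(val (lift j (Ordinal lm))) seq_ofE.
Qed.

Local Ltac split_vertices r y :=
  case: ifP => ?; try (case: ifP => ?); rewrite //; try (exfalso; lia);
  first [apply: (congr1 (fun t => r (y t))); lia | apply: (congr1 y); lia].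

(** The prism joins a tuple to its image under [r]. Its inner faces cancel in pairs, which leaves
    the two ends. *)
Lemma prism_homotopy m n (f : cochain V m.+1 n) :
  cobound (prism f) + prism (cobound f) =
  f - linf_pull (fun (x : 'I_m.+1 -> G) i => r (x i)) f.
Proof.
apply: linfP => x; pose y := seq_of x.
(* [q] moves from [f] to its pullback by applying [r] to one more entry at a time. [A i j] uses
   prism simplex [i] of face [j], and [B i j] uses face [j] of prism simplex [i]. *)
pose q i := f (fun l : 'I_m.+1 => if (l < i)%N then r (y l) else y l).
pose A i j := f (fun l : 'I_m.+1 => prism_vertex i (y \o bump j) l).
pose B i j := f (fun l : 'I_m.+1 => prism_vertex i y (bump j l)).
transitivity (q 0 - q m.+1); last first.
  congr (f _ - f _); apply/funext => l /=; rewrite /y ?ltn_ord seq_ofE//.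
have bumpP j l : (j <= l /\ bump j l = l.+1 \/ l < j /\ bump j l = l)%N.
  by rewrite /bump; case: leqP => jl; [left|right].
(* The four face identities, last one first, are checked vertex by vertex according to the position
   of the omitted index. *)
rewrite -(@prism_telescope _ _ m A B q); first last.
- move=> i j ij; congr (f _); apply/funext => l; rewrite /prism_vertex /=.
  have [[h ->]|[h ->]] := bumpP j.+1 l; have [[k E]|[k E]] := bumpP j l;
    have [[k' E']|[k' E']] := bumpP j l.-1; rewrite ?E ?E';
    split_vertices r y.
- move=> i; congr (f _); apply/funext => l; rewrite /prism_vertex /=.
  have [[h ->]|[h ->]] := bumpP i.+1 l;
    split_vertices r y.
- move=> i; congr (f _); apply/funext => l; rewrite /prism_vertex /=.
  have [[h ->]|[h ->]] := bumpP i l;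
    split_vertices r y.
- move=> i j ij; congr (f _); apply/funext => l; rewrite /prism_vertex /=.
  have [[h ->]|[h ->]] := bumpP j l;
    have [[k' E']|[k' E']] := bumpP j l.-1; rewrite ?E';
    split_vertices r y.
rewrite linfD addrC; congr (_ + _).
  rewrite linf_sumE big_mkord; apply: eq_bigr => i _.
  rewrite linfZ /= linf_sumE big_mkord scaler_sumr; apply: eq_bigr => j _.
  by rewrite linfZ scalerA -exprD.
(* In [cobound (prism f)] the outer sum runs over the omitted entry, so the double sum of the
   [A i j] is transposed. *)
rewrite exchange_big linf_sumE big_mkord; apply: eq_bigr => j _.
rewrite linfZ /= linf_sumE big_mkord scaler_sumr; apply: eq_bigr => i _.
rewrite linfZ scalerA -exprD addnC; congr (_ *: f _); apply/funext => l.
have lm := ltn_ord l; have im := ltn_ord i.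
by rewrite /prism_vertex; case: leqP => li /=; rewrite seq_of_lift//; lia.
Qed.

End Prism.

(** * Inflation along an equivariant retraction onto the subgroup *)

Section Retraction.
Variables (R : realType) (omega : npUltrafilter) (G : groupType).
Variables (S : groupClosed G) (L : subGroupType (fun x : G => x \in S)).

(* [x |-> x * t x], where [t x] depends only on the coset [S * x] and lies in
   its inverse. *)
Lemma equivariant_retraction :
  exists r : G -> L, forall (l : L) (x : G), r (\val l * x)%g = (l * r x)%g.
Proof.
pose t (x : G) := repr (\pi_(lcoset_space S) x^-1%g).
have tS x : (x * t x)%g \in S.
  have /eqP : \pi_(lcoset_space S) (t x) = \pi_(lcoset_space S) x^-1%g.
    by rewrite /t reprK.
  by rewrite eq_sym piE /coset_rel invgK.
have tE (l : L) x : t (\val l * x)%g = t x.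
  congr (repr _); apply/eqP; rewrite eq_sym piE /coset_rel invgK invgM.
  by rewrite mulVKg gpredV; exact: (valP l).
exists (fun x => Sub (x * t x)%g (tS x)) => l x; apply: val_inj.
by rewrite SubK valM SubK tE mulgA.
Qed.

Variables (V : asympModule R omega G) (r : G -> L).
Hypothesis rE : forall (l : L) (x : G), r (\val l * x)%g = (l * r x)%g.

Definition infl m n : cochain (res_module L V) m n -> cochain V m n :=
  linf_pull (fun (x : 'I_m -> G) i => r (x i)).
HB.instance Definition _ m n := GRing.Linear.on (@infl m n).

Lemma infl_unif_bounded m : unif_bounded (@infl m).
Proof. by exists 1 => n f; rewrite mul1r linf_pull_norm. Qed.

Definition tinfl m : tcochain (res_module L V) m -> tcochain V m :=
  tilde_map (infl_unif_bounded m).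

Lemma tinfl_cobound m (h : tcochain (res_module L V) m) :
  tinfl (tcobound h) = tcobound (tinfl h).
Proof.
apply: tilde_map_square; near=> n => x; rewrite /cobound /infl raddf_sum.
by apply: eq_bigr => j _; apply: linfP.
Unshelve. all: by end_near. Qed.

(** By equivariance of [r], an invariant cochain of the subgroup inflates to a cochain on [G] fixed
    by the subgroup. *)
Lemma tinfl_act m (l : star omega L) (h : tcochain (res_module L V) m) :
  tcochain_act (star_val l) (tinfl h) = tinfl (tcochain_act l h).
Proof.
apply: tilde_map_square; near=> n => x; apply: linfP => y /=.
have -> : urepr (star_val l) n = \val (urepr l n) by near: n; exact: urepr_class.
congr (rep_act _ _ _ (x _)); apply/funext => i.
by rewrite -rE gmulfV.
Unshelve. all: by end_near. Qed.

Let rG x : G := \val (r x).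

(** Left translation by [l] commutes with [r], hence permutes the prism simplices. This makes the
    primitive built from the prism invariant under the subgroup. *)
Lemma tprism_act m (l : star omega L) (f : tcochain V m.+1) :
  tcochain_act (star_val l) (tprism rG f) =
  tprism rG (tcochain_act (star_val l) f).
Proof.
apply: tilde_map_square; near=> n => x; apply: linfP => y.
have -> : urepr (star_val l) n = \val (urepr l n) by near: n; exact: urepr_class.
rewrite /= /prism !linf_sumE raddf_sum; apply: eq_bigr => i _.
rewrite !linfZ. apply: (etrans (linearZ_LR _ _ _)).
congr (_ *: rep_act _ _ _ (x _)).
apply/funext => k; have im := ltn_ord i; have km := ltn_ord k.
rewrite /prism_vertex; case: leqP => ki.
  rewrite -[nat_of_ord k]/(val (Ordinal (leq_ltn_trans ki im))) !seq_ofE /rG.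
  by rewrite -gmulfV rE valM.
have k1 : (k.-1 < m)%N by lia.
by rewrite -[k.-1]/(val (Ordinal k1)) !seq_ofE.
Unshelve. all: by end_near. Qed.

Lemma tprism_homotopy m (f : tcochain V m.+1) :
  f - tinfl (tres L f) = tcobound (tprism rG f) + tprism rG (tcobound f).
Proof.
apply/eqP; rewrite -subr_eq; apply/eqP.
have [x [xb ->]] := tilde_ex f.
rewrite /tcobound /tres /tinfl /tprism !tilde_map_class.
rewrite !tildeB; apply/tildeP => e e0; near=> n.
rewrite [X in `|X|](_ : _ = 0) ?normr0//; apply/eqP.
by rewrite subr_eq0 subr_eq prism_homotopy; apply/eqP; congr (_ - _); apply: linfP.
Unshelve. all: by end_near. Qed.

End Retraction.

(** * Means of functions with values in a dual space *)

Section WeakMean.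
Variables (R : realType) (C : Type) (V W : normedModType R).
Variables (m : {linear linf C R^o -> R^o}).
Hypothesis m1 : m (linf_one R C) = 1.
Hypothesis m_le : forall f, `|m f| <= `|f|.
Variable T : {linear V -> cdual W}.
Hypothesis T_bij : bijective T.
Hypothesis T_isom : forall v, `|T v| = `|v|.

Lemma weak_eval_subproof (F : linf C V) (w : W) :
  (fun c => T (F c) w : R^o) \in bounded_fct C R^o.
Proof.
apply/asboolP; exists (`|F| * `|w|) => c; rewrite (le_trans (le_cdual_norm _ _))//.
by rewrite ler_wpM2r// -[cdual_norm _]/(`|T (F c)|) T_isom le_linf.
Qed.

Definition weak_eval F w : linf C R^o := Linf (weak_eval_subproof F w).

Lemma weak_eval_le F w : `|m (weak_eval F w)| <= `|F| * `|w|.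
Proof.
rewrite (le_trans (m_le _))//; apply: linf_le => [|c]; first by rewrite mulr_ge0.
rewrite (le_trans (le_cdual_norm _ _))//.
by rewrite ler_wpM2r// -[cdual_norm _]/(`|T (F c)|) T_isom le_linf.
Qed.

Lemma weak_integral_linear F : linear (fun w => m (weak_eval F w) : R^o).
Proof.
move=> a u w; rewrite -linearP; congr (m _); apply: linfP => c.
by rewrite /= linearP.
Qed.

Lemma weak_integral_subproof F :
  (fun w => m (weak_eval F w) : R^o) \in cdual_pred W.
Proof.
apply/asboolP; split; first exact: weak_integral_linear.
pose h : {linear W -> R^o} := HB.pack (fun w => m (weak_eval F w) : R^o)
  (GRing.isLinear.Build R W R^o _ _ (weak_integral_linear F)).
apply: (@bounded_linear_continuous _ _ _ h); apply/linear_boundedP.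
exists `|F|; split=> [|s /ltW Fs w]; first exact: num_real.
by rewrite (le_trans (weak_eval_le F w))// ler_wpM2r.
Qed.

(** The weak-* integral of [F] against [m], still in the dual of [W]; the inverse of [T] brings it
    back to [V]. *)
Definition weak_integral F : cdual W := Cdual (weak_integral_subproof F).

(** Pairing with all [w] separates the points of [V], so each property reduces to one of [m]. The
    last clause asks for an adjoint [B] on the predual because a general bounded operator need not
    commute with weak-* integrals. *)
Lemma weak_mean : exists M : {linear linf C V -> V},
  [/\ forall (F : linf C V) v, (forall c, F c = v) -> M F = v,
      forall F, `|M F| <= `|F|,
      forall u : C -> C, (forall f, m (linf_pull u f) = m f) ->
        forall F, M (linf_pull u F) = M F
    & forall (A : V -> V) (B : W -> W), (forall v w, T (A v) w = T v (B w)) ->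
        forall F F' : linf C V, (forall c, F' c = A (F c)) -> M F' = A (M F)].
Proof.
have [T' TK T'K] := T_bij.
pose M F := T' (weak_integral F).
have ME F w : T (M F) w = m (weak_eval F w) by rewrite /M T'K.
have Minj v v' : (forall w, T v w = T v' w) -> v = v'.
  by move=> h; apply: (can_inj TK); apply: cdualP.
have Mlin : linear M.
  move=> a F F'; apply: Minj => w; rewrite linearP.
  rewrite [RHS](_ : _ = a * T (M F) w + T (M F') w)// !ME -linearP.
  by congr (m _); apply: linfP => c; rewrite /= linearP.
pose Ml : {linear linf C V -> V} :=
  HB.pack M (GRing.isLinear.Build R (linf C V) V _ _ Mlin).
exists Ml; split => /=.
- move=> F v Fv; apply: Minj => w; rewrite ME.
  rewrite (_ : weak_eval F w = T v w *: linf_one R C).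
    by rewrite linearZ/= m1 [LHS]mulr1.
  by apply: linfP => c; rewrite linfZ /= Fv [RHS]mulr1.
- move=> F; rewrite -T_isom; apply: cdual_norm_le => w w1; rewrite ME.
  by rewrite (le_trans (weak_eval_le _ _))// ler_piMr.
- move=> u mu F; apply: Minj => w; rewrite !ME -[RHS]mu.
  by congr (m _); apply: linfP.
- move=> A B AB F F' FF'; apply: Minj => w; rewrite AB !ME.
  by congr (m _); apply: linfP => c /=; rewrite FF' AB.
Qed.

End WeakMean.

(** * Asymptotic identities, uniform in the group elements *)

Section UniformInvariance.
Variables (R : realType) (omega : npUltrafilter) (G : groupType).
Variable V : asympModule R omega G.

(** A sequence of worst triples [(g, h, v)] defines two elements of the ultrapower and a bounded
    vector, to which [tilde_actM] applies. *)
Lemma act_mul_near (e : R) : 0 < e ->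
  \forall n \near npuf omega, forall (g h : G) (v : rep_space V n), `|v| <= 1 ->
    `|rep_act V n (g * h)%g v - rep_act V n g (rep_act V n h v)| < e.
Proof.
move=> e0.
have := @near_forall omega (fun n => (G * G * rep_space V n)%type)
  (fun n a => `|a.2| <= 1 -> `|rep_act V n (a.1.1 * a.1.2)%g a.2 -
    rep_act V n a.1.1 (rep_act V n a.1.2 a.2)| < e).
move=> H; suff : \forall n \near npuf omega,
    forall a : G * G * rep_space V n, `|a.2| <= 1 ->
    `|rep_act V n (a.1.1 * a.1.2)%g a.2 -
    rep_act V n a.1.1 (rep_act V n a.1.2 a.2)| < e.
  by apply: filterS => n h g k v; exact: (h (g, k, v)).
apply: H => [n|a]; first by constructor; exact: (1%g, 1%g, 0).
(* Outside the unit ball there is nothing to prove; putting 0 there makes the sequence bounded. *)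
pose v n : rep_space V n := if `|(a n).2| <= 1 then (a n).2 else 0.
have vb : uclass omega v \in ubounded omega (fun n => rep_space V n).
  apply/uboundedP; exists 1; near=> n.
  by rewrite /v; case: ifP; rewrite ?normr0.
pose g := uclass omega (fun n => (a n).1.1).
pose h := uclass omega (fun n => (a n).1.2).
have := tilde_actM g h (sqclass (uinfinitesimal omega _) vb).
rewrite /tilde_act (tilde_map_class (act_unif_bounded V h) vb) !tilde_map_class.
move=> /tildeP /(_ e e0) E; near=> n => an.
have : `|rep_act V n (urepr (g * h)%g n) (v n) -
    rep_act V n (urepr g n) (rep_act V n (urepr h n) (v n))| < e by near: n.
have -> : urepr g n = (a n).1.1 by near: n; exact: urepr_class.
have -> : urepr h n = (a n).1.2 by near: n; exact: urepr_class.
have -> : urepr (g * h)%g n = ((a n).1.1 * (a n).1.2)%g.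
  near: n; rewrite [(g * h)%g]umap2E; exact: urepr_class.
by rewrite /v an.
Unshelve. all: by end_near. Qed.

Lemma act_mul_near_scaled (e : R) : 0 < e ->
  \forall n \near npuf omega, forall (g h : G) (v : rep_space V n),
    `|rep_act V n (g * h)%g v - rep_act V n g (rep_act V n h v)| <= e * `|v|.
Proof.
move=> e0; have := act_mul_near e0; apply: filterS => n H g h v.
have [->|v0] := eqVneq v 0.
  have act0 k : rep_act V n k 0 = 0 by exact: linear0.
  by rewrite !act0 subr0 !normr0 mulr0.
have nv : 0 < `|v| by rewrite normr_gt0.
rewrite -ler_pdivrMr// ltW//; have := H g h (`|v|^-1 *: v).
have actZ k a u : rep_act V n k (a *: u) = a *: rep_act V n k u by exact: linearZ.
rewrite !actZ -scalerBr !normrZ normfV normr_id mulVf ?gt_eqF//.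
by rewrite mulrC => ->.
Qed.

(** The map [u] covers both uses: invariance under the whole group, with the identity, and under a
    subgroup, with its inclusion. *)
Lemma act_invariant_near (A : Type) (a0 : A) (u : A -> G) m
    (x : forall n, cochain V m n)
    (xb : uclass omega x \in ubounded omega (cochain V m)) :
  (forall a : star omega A,
     tcochain_act (umap (fun=> u) a) (sqclass (uinfinitesimal omega _) xb) =
     sqclass (uinfinitesimal omega _) xb) ->
  forall e : R, 0 < e -> \forall n \near npuf omega,
    forall a, `|cochain_act (u a) (x n) - x n| < e.
Proof.
move=> H e e0; apply: (@near_forall omega (fun=> A)
  (fun n a => `|cochain_act (u a) (x n) - x n| < e)) => [n|a].
  by constructor.
have := H (uclass omega a).
rewrite /tcochain_act tilde_map_class => /tildeP /(_ e e0) E; near=> n.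
have <- : urepr (umap (fun=> u) (uclass omega a)) n = u (a n).
  by near: n; rewrite umapE; exact: urepr_class.
by near: n.
Unshelve. all: by end_near. Qed.

End UniformInvariance.

(** * Averaging cochains over the cosets *)

Section Transfer.
Variables (R : realType) (omega : npUltrafilter) (G : groupType).
Variables (S : groupClosed G) (V : asympModule R omega G).

Let C := lcoset_space S.
Let section (c : C) : G := repr c.

Variable M : forall n, {linear linf C (rep_space V n) -> rep_space V n}.
Hypothesis M_le : forall n F, `|M n F| <= `|F|.

Lemma mean_le_dist n (F F' : linf C (rep_space V n)) (e : R) :
  0 <= e -> (forall c, `|F c - F' c| <= e) -> `|M n F - M n F'| <= e.
Proof.
move=> e0 FF'; rewrite -linearB (le_trans (M_le _))//.
by apply: linf_le => // c; exact: FF'.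
Qed.

Section Cochains.
Variables m n : nat.
Implicit Type f : cochain V m n.

Lemma translates_subproof f (x : 'I_m -> G) :
  (fun c : C => rep_act V n (section c) (f (fun i => (section c)^-1 * x i)%g))
    \in bounded_fct C (rep_space V n).
Proof. by apply/asboolP; exists `|f| => c; rewrite rep_act_isom le_linf. Qed.

(** The values at [x] of the translates of [f] by coset representatives. Representatives are chosen
    because a cochain invariant only up to infinitesimals has translates that depend on them, if
    only infinitesimally. *)
Definition translates f x : linf C (rep_space V n) :=
  Linf (translates_subproof f x).

Lemma mean_translates_le f x : `|M n (translates f x)| <= `|f|.
Proof.
by rewrite (le_trans (M_le _))//; apply: linf_le => // c; rewrite rep_act_isom le_linf.
Qed.

Lemma transfer_subproof f :
  (fun x => M n (translates f x)) \in bounded_fct ('I_m -> G) (rep_space V n).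
Proof. by apply/asboolP; exists `|f| => x; exact: mean_translates_le. Qed.

Definition transfer f : cochain V m n := Linf (transfer_subproof f).

Lemma transfer_is_linear : linear transfer.
Proof.
move=> a f h; apply: linfP => x; rewrite linfD linfZ /= -linearP.
by congr (M n _); apply: linfP => c; rewrite /= linearP.
Qed.
HB.instance Definition _ :=
  GRing.isLinear.Build R (cochain V m n) (cochain V m n) _ _ transfer_is_linear.

Lemma transfer_norm f : `|transfer f| <= `|f|.
Proof. by apply: linf_le => // x; exact: mean_translates_le. Qed.

End Cochains.

Lemma transfer_unif_bounded m : unif_bounded (@transfer m).
Proof. by exists 1 => n f; rewrite mul1r transfer_norm. Qed.

Definition ttransfer m : tcochain V m -> tcochain V m :=
  tilde_map (transfer_unif_bounded m).

(** Omitting an entry commutes with translation, so linearity of [M] suffices, exactly and in every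
    coordinate. *)
Lemma ttransfer_cobound m (f : tcochain V m) :
  ttransfer (tcobound f) = tcobound (ttransfer f).
Proof.
apply: tilde_map_square; near=> n => x; rewrite /cobound raddf_sum.
apply: eq_bigr => j _; apply: (etrans (linearZ_LR _ _ _)); congr (_ *: _).
by apply: linfP => y; congr (M n _); apply: linfP.
Unshelve. all: by end_near. Qed.

Hypothesis M_cst : \forall n \near npuf omega,
  forall (F : linf C (rep_space V n)) v, (forall c, F c = v) -> M n F = v.
Hypothesis M_inv : \forall n \near npuf omega,
  forall g (F : linf C (rep_space V n)), M n (linf_pull (lcoset_act g) F) = M n F.
Hypothesis M_act : \forall n \near npuf omega,
  forall g (F F' : linf C (rep_space V n)),
    (forall c, F' c = rep_act V n g (F c)) -> M n F' = rep_act V n g (M n F).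

(** All translates of an invariant cochain are uniformly close to it, hence so is their mean. *)
Lemma ttransfer_invariant_id m (f : tcochain V m) :
  Defs.invariant f -> ttransfer f = f.
Proof.
have [x [xb ->]] := tilde_ex f => fi; rewrite /ttransfer tilde_map_class.
apply/tildeP => e e0; have e2 : 0 < e / 2 by rewrite divr_gt0.
have umap_id (g : star omega G) : umap (fun=> id) g = g by exact: ureprK.
have := @act_invariant_near _ _ _ V G 1%g id m x xb.
move=> /(_ _ _ e2) /= H; near=> n.
(* The sup norm only yields a non-strict bound, so the margin [e / 2] is kept. *)
rewrite (@le_lt_trans _ _ (e / 2))//; last lra.
apply: linf_le => [|y]; first exact: ltW.
have cstb (v : rep_space V n) : (fun _ : C => v) \in bounded_fct C (rep_space V n).
  by apply/asboolP; exists `|v|.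
have Mc : forall (F : linf C (rep_space V n)) v, (forall c, F c = v) -> M n F = v.
  by near: n.
(* The value [x n y] is the mean of a constant function, so two means are compared coset by
   coset. *)
have -> : (transfer (x n) - x n) y = M n (translates (x n) y) - M n (Linf (cstb (x n y))).
  by rewrite (Mc (Linf _) (x n y)).
apply: mean_le_dist => [|c]; first exact: ltW.
have Hn : forall g, `|cochain_act g (x n) - x n| < e / 2.
  by near: n; apply: H => a; rewrite umap_id.
by rewrite (le_trans _ (ltW (Hn (section c))))//;
  exact: (le_linf (cochain_act _ _ - _) y).
Unshelve. all: by end_near. Qed.

Variable L : subGroupType (fun x : G => x \in S).

(* For [t] the representative of [g * c], [g * section c = t * l] with [l] in
   [S]; replacing [t * l] by [t] costs the defect of multiplicativity of the
   action, and the defect of invariance of [f] under [l]. *)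
Lemma ttransfer_invariant m (f : tcochain V m) :
  (forall l : star omega L, tcochain_act (star_val l) f = f) ->
  Defs.invariant (ttransfer f).
Proof.
have [x [xb ->]] := tilde_ex f => fi g.
rewrite /ttransfer tilde_map_class /tcochain_act tilde_map_class.
apply/tildeP => e e0; have e4 : 0 < e / 4 by rewrite divr_gt0.
have Hl := act_invariant_near (1%g : L) (u := fun l : L => \val l) fi e4.
have /uboundedP[K hK] := xb.
(* Since [K] bounds the norm of [x n], the defect of multiplicativity on values of [x n] is at most
   [e / 4]; the added 1 keeps the denominator positive. Three errors of this size will occur. *)
pose d := e / 4 / (`|K| + 1).
have K0 : 0 < `|K| + 1 by rewrite ltr_wpDl.
have d0 : 0 < d by rewrite divr_gt0.
have Ha := act_mul_near_scaled V d0.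
near=> n; set h := urepr g n.
have xK : d * `|x n| <= e / 4.
  rewrite /d mulrAC ler_pdivrMr// ler_wpM2l//; first exact: ltW.
  rewrite (@le_trans _ _ K)//; first by near: n.
  by rewrite (le_trans (ler_norm _))// lerDl.
rewrite (@le_lt_trans _ _ (3 * (e / 4)))//; last lra.
apply: linf_le => [|y]; first by rewrite mulr_ge0// ltW.
have actb (F : linf C (rep_space V n)) :
    (fun c => rep_act V n h (F c)) \in bounded_fct C (rep_space V n).
  by apply/asboolP; exists `|F| => c; rewrite rep_act_isom le_linf.
have Mi : forall g (F : linf C (rep_space V n)),
  M n (linf_pull (lcoset_act g) F) = M n F by near: n.
have Ma : forall g (F F' : linf C (rep_space V n)),
  (forall c, F' c = rep_act V n g (F c)) -> M n F' = rep_act V n g (M n F).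
  by near: n.
have Hln : forall l : L, `|cochain_act (\val l) (x n) - x n| < e / 4 by near: n.
have Han : forall (g h : G) (v : rep_space V n),
    `|rep_act V n (g * h)%g v - rep_act V n g (rep_act V n h v)| <= d * `|v|.
  by near: n.
pose y' i := (h^-1 * y i)%g.
(* The action of [h] passes inside the first mean, and the second is reindexed by [h] on the cosets,
   so that the integrands agree up to a small error. *)
have -> : (cochain_act h (transfer (x n)) - transfer (x n)) y =
    M n (Linf (actb (translates (x n) y'))) -
    M n (linf_pull (lcoset_act h) (translates (x n) y)).
  by rewrite Mi (Ma h (translates (x n) y')).
apply: mean_le_dist => [|c]; first by rewrite mulr_ge0// ltW.
rewrite /=; set s := section c; set t := section _.
have lS : (t^-1 * (h * s))%g \in S.
  have /eqP : \pi_C t = \pi_C (h * s)%g by rewrite /t /section reprK.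
  by rewrite piE.
pose l : L := Sub (t^-1 * (h * s))%g lS.
have lE : (h * s)%g = (t * \val l)%g by rewrite SubK mulVKg.
pose z i := (t^-1 * y i)%g.
pose v := x n (fun i => (\val l)^-1 * z i)%g.
have vE : x n (fun i => s^-1 * y' i)%g = v.
  congr (x n _); apply/funext => i; rewrite /y' /z !mulgA; congr (_ * _)%g.
  by rewrite -!invgM lE.
have vx : `|v| <= `|x n| by exact: le_linf.
have dv : d * `|v| <= e / 4 by rewrite (le_trans _ xK)// ler_wpM2l// ltW.
rewrite vE.
have A1 := Han h s v; have A2 := Han t (\val l) v.
have A3 : `|rep_act V n t (rep_act V n (\val l) v) - rep_act V n t (x n z)| <= e / 4.
  rewrite -linearB rep_act_isom (le_trans _ (ltW (Hln l)))//.
  exact: (le_linf (cochain_act _ _ - _) z).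
rewrite lE in A1.
rewrite [X in `|X|](_ : _ =
  (* The path goes from [h (s v)] to [(h s) v = (t l) v], then to [t (l v)], then to [t (x n z)]. *)
  - (rep_act V n (t * \val l)%g v - rep_act V n h (rep_act V n s v)) +
  (rep_act V n (t * \val l)%g v - rep_act V n t (rep_act V n (\val l) v)) +
  (rep_act V n t (rep_act V n (\val l) v) - rep_act V n t (x n z))); last first.
  by rewrite opprB !addrA !subrK.
rewrite (le_trans (ler_normD _ _))//.
have := ler_normD (- (rep_act V n (t * \val l)%g v - rep_act V n h (rep_act V n s v)))
  (rep_act V n (t * \val l)%g v - rep_act V n t (rep_act V n (\val l) v)).
rewrite normrN; lra.
Unshelve. all: by end_near. Qed.

End Transfer.

(** * The means given by coamenability, and injectivity of restriction *)

Lemma dual_module_means (R : realType) (omega : npUltrafilter) (G : groupType)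
    (S : groupClosed G) (V : asympModule R omega G) :
  coamenable R S -> dual_asympModule V ->
  exists M : forall n,
      {linear linf (lcoset_space S) (rep_space V n) -> rep_space V n},
    [/\ forall n F, `|M n F| <= `|F|,
        \forall n \near npuf omega,
          forall (F : linf (lcoset_space S) (rep_space V n)) v,
            (forall c, F c = v) -> M n F = v,
        \forall n \near npuf omega,
          forall g (F : linf (lcoset_space S) (rep_space V n)),
            M n (linf_pull (lcoset_act g) F) = M n F
      & \forall n \near npuf omega,
          forall g (F F' : linf (lcoset_space S) (rep_space V n)),
            (forall c, F' c = rep_act V n g (F c)) ->
            M n F' = rep_act V n g (M n F)].
Proof.
move=> [m [m1 m_le m_inv]] [W VW].
pose good n (M : {linear linf (lcoset_space S) (rep_space V n) -> rep_space V n}) :=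
  [/\ forall (F : linf (lcoset_space S) (rep_space V n)) v,
        (forall c, F c = v) -> M F = v,
      forall g F, M (linf_pull (lcoset_act g) F) = M F
    & forall g (F F' : linf (lcoset_space S) (rep_space V n)),
        (forall c, F' c = rep_act V n g (F c)) -> M F' = rep_act V n g (M F)].
pose dual n := exists T : {linear rep_space V n -> cdual (rep_space W n)},
  [/\ bijective T, forall v, `|T v| = `|v|
    & forall g v, T (rep_act V n g v) = contragredient g (T v)].
have exM n : {M : {linear linf (lcoset_space S) (rep_space V n) -> rep_space V n} |
    (forall F, `|M F| <= `|F|) /\ (dual n -> good n M)}.
  apply: cid; have [[T [T_bij T_isom T_act]]|ndual] := pselect (dual n).
    have [M [M_cst M_le M_inv M_act]] := weak_mean m1 m_le T_bij T_isom.
    exists M; split=> // _; split=> // g F.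
      by apply: M_inv => f; rewrite -[in LHS](invgK g) m_inv.
    (* The action of [g] on [V] is adjoint to that of [g^-1] on the predual. *)
    move=> F'; apply: (M_act _ (rep_act W n g^-1%g)) => v w.
    by rewrite T_act.
  (* Where no predual is available, the zero map has the norm bound, the one property demanded in
     every coordinate. *)
  by exists \0; split=> // F; rewrite normr0.
exists (fun n => sval (exM n)); split.
- by move=> n; have [] := svalP (exM n).
- by apply: filterS VW => n Vn; have [_ /(_ Vn)[]] := svalP (exM n).
- by apply: filterS VW => n Vn; have [_ /(_ Vn)[]] := svalP (exM n).
- by apply: filterS VW => n Vn; have [_ /(_ Vn)[]] := svalP (exM n).
Qed.

Theorem proposition1p8 (R : realType) (omega : npUltrafilter)
    (Gamma : groupType) (S : groupClosed Gamma)
    (Lambda : subGroupType (fun x : Gamma => x \in S)) :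
  countable [set: Gamma] ->
  coamenable R S ->
  forall (n : nat) (V : asympModule R omega Gamma),
    dual_asympModule V ->
    injective (@restriction R omega Gamma S Lambda V n).
Proof.
move=> _ amen n V dualV.
suff ker0 (z : acohomology V n) : restriction Lambda z = 0 -> z = 0.
  move=> z z' zz'; apply/eqP; rewrite -subr_eq0; apply/eqP/ker0.
  by rewrite raddfB /= zz' subrr.
have [M [M_le M_cst M_inv M_act]] := dual_module_means amen dualV.
have [r rE] := equivariant_retraction Lambda.
pose T m := @ttransfer R omega Gamma S V M M_le m.
pose rG x : Gamma := \val (r x).
have [f [fZ ->]] : exists f (fZ : f \in cocycle V n),
    z = sqclass (coboundary V n) fZ.
  by exists (sqrepr z), (sqreprP z); rewrite sqreprK.
rewrite /restriction subquot_mapE; last exact: tres_coboundary.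
rewrite -[X in _ = X -> _]sqclass0 -[X in _ -> _ = X]sqclass0.
move=> /sqclassP; rewrite subr0 => resf; apply/sqclassP; rewrite subr0.
have /asboolP[fi fd] := fZ.
(* As [f] is a cocycle, the homotopy formula becomes [f - infl (res f) = d (K f)]. *)
have := tprism_homotopy r f; rewrite fd [tprism _ 0]raddf0 addr0.
case: n f {z fZ} fi fd resf => [|k] f fi fd resf fE.
  (* In degree 0 the only coboundary is 0, so [res f = 0]; and [K f] vanishes, being an empty sum
     over prism simplices. *)
  have res0 : tres Lambda f = 0 by apply/eqP; exact: resf.
  apply/eqP.
  move: fE; rewrite res0 [tinfl r _]raddf0 subr0 => ->.
  rewrite [tprism _ f](_ : _ = 0) ?[tcobound 0]raddf0//.
  have [x [xb ->]] := tilde_ex f; rewrite /tprism tilde_map_class -sqclass0.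
  by apply/sqclassP; rewrite subr0; apply/uinfinitesimalP => e e0; near=> j;
    rewrite /= /prism big_ord0 normr0.
have /asboolP[h hi res_h] := resf.
have resE : tres Lambda f = tcobound h by exact: res_h.
(* From [res f = d h] follows [f = d (infl h + K f)], a primitive fixed by the subgroup. *)
pose h' := tinfl r h + tprism rG f.
have fE' : f = tcobound h'.
  by rewrite /tcobound raddfD -[X in _ + X]fE resE tinfl_cobound addrC subrK.
have h'i (l : star omega Lambda) : tcochain_act (star_val l) h' = h'.
  rewrite /tcochain_act raddfD; congr (_ + _).
    by rewrite -[RHS](congr1 _ (hi l)); exact: tinfl_act.
  rewrite -[in RHS](fi (star_val l)); exact: tprism_act.
(* The average of [h'] is invariant under [Gamma] and still a primitive:
   [d (T h') = T (d h') = T f = f]. *)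
apply/asboolP; exists (T _ h'); first exact: ttransfer_invariant h'i.
rewrite -[LHS](ttransfer_invariant_id M_le M_cst fi) fE'.
exact: ttransfer_cobound.
Unshelve. all: by end_near. Qed.
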